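(* Let $n\ge 1$. The number of distinct interval posets $P(\pi)$, $\pi\in\mathcal{S}_n$ (i.e. interval posets with $n$ minimal elements), is equal to the number of diagonally framed dissections of the convex $(n+1)$-gon in which no quadrilaterals are present.
   Context: For $\pi=a_1\cdots a_n\in\mathcal{S}_n$, an interval (block) of $\pi$ is a non-empty contiguous sequence of entries $a_ia_{i+1}\cdots a_{i+k}$ whose values form a contiguous set of integers $[a,b]=\{a,a+1,\dots,b\}$; intervals are identified with their value sets. The interval poset $P(\pi)$ is the set of all non-empty intervals of $\pi$, ordered by inclusion; its minimal elements are the singletons $\{1\},\dots,\{n\}$. Two interval posets are considered the same when they consist of the same family of intervals. Label the vertices of the convex $(n+1)$-gon $1,2,\dots,n+1$ in cyclic order, and write $\{i,j\}$ for the segment (side or diagonal) joining vertices $i$ and $j$. A dissection is a set of diagonals (crossings allowed). A dissection is diagonally framed if whenever two chosen diagonals $\{a,b\}$ and $\{c,d\}$ cross, the segments $\{a,d\},\{b,d\},\{c,b\},\{c,a\}$ are all either sides of the polygon or chosen diagonals. A quadrilateral is present in the dissection if there are vertices $a<b<c<d$ such that $\{a,b\},\{b,c\},\{c,d\},\{a,d\}$ are all sides or chosen diagonals and the quadrilateral they bound is not subdivided, i.e. no chosen diagonal meets its interior. *)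

(* Defs.v *)
(* Entries, values and polygon vertices are numbered from 0: the
   integers 1, ..., n are 'I_n and the vertices 1, ..., n+1 are 'I_n.+1. *)
From mathcomp Require Import all_boot all_fingroup.

Set Implicit Arguments.
Unset Strict Implicit.
Unset Printing Implicit Defensive.

Definition contiguous (n : nat) (B : {set 'I_n}) : bool :=
  [exists a : 'I_n, exists b : 'I_n,
     (a <= b) && (B == [set k : 'I_n | a <= k <= b])].

(* The permutation a_1 ... a_n is s with a_i = s i; the block of entries at the
   positions I is recorded by its value set s @: I.  The order is inclusion, so
   the poset is determined by this family of sets. *)
Definition interval_poset (n : nat) (s : 'S_n) : {set {set 'I_n}} :=
  [set s @: I | I : {set 'I_n} & contiguous I && contiguous (s @: I)].

(* Segments between distinct vertices are two-element vertex sets; ordS is the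
   cyclic successor, so the side closing up the polygon is included. *)
Definition is_side (n : nat) (e : {set 'I_n.+1}) : bool :=
  (#|e| == 2) && [exists i : 'I_n.+1, e == [set i; ordS i]].

Definition is_diagonal (n : nat) (e : {set 'I_n.+1}) : bool :=
  (#|e| == 2) && ~~ is_side e.

Definition is_dissection (n : nat) (D : {set {set 'I_n.+1}}) : bool :=
  [forall e in D, is_diagonal e].

Definition drawn (n : nat) (D : {set {set 'I_n.+1}}) (e : {set 'I_n.+1}) : bool :=
  is_side e || (e \in D).

(* In a convex polygon two segments meet at a point interior to both exactly
   when their four endpoints are distinct and alternate around the boundary. *)
Definition crosses (n : nat) (e f : {set 'I_n.+1}) : bool :=
  [exists a : 'I_n.+1, exists b : 'I_n.+1, exists c : 'I_n.+1, exists d : 'I_n.+1,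
    [&& a < b, b < c, c < d &
       (e == [set a; c]) && (f == [set b; d])
    || (e == [set b; d]) && (f == [set a; c])]].

Definition diagonally_framed (n : nat) (D : {set {set 'I_n.+1}}) : bool :=
  [forall a : 'I_n.+1, forall b : 'I_n.+1, forall c : 'I_n.+1, forall d : 'I_n.+1,
    [&& [set a; b] \in D, [set c; d] \in D & crosses [set a; b] [set c; d]] ==>
    [&& drawn D [set a; d], drawn D [set b; d],
        drawn D [set c; b] & drawn D [set c; a]]].

(* A diagonal e meets the interior of the convex hull of the vertex set Q iff
   some two vertices of Q lie strictly on opposite sides of e, that is, iff e
   crosses the segment joining them.  (For a quadrilateral Q this covers both
   the diagonals of Q itself and the diagonals crossing a side of Q.) *)
Definition meets_interior (n : nat) (e Q : {set 'I_n.+1}) : bool :=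
  [exists p in Q, exists q in Q, crosses e [set p; q]].

Definition has_quadrilateral (n : nat) (D : {set {set 'I_n.+1}}) : bool :=
  [exists a : 'I_n.+1, exists b : 'I_n.+1, exists c : 'I_n.+1, exists d : 'I_n.+1,
    [&& a < b, b < c, c < d,
        drawn D [set a; b], drawn D [set b; c],
        drawn D [set c; d], drawn D [set a; d] &
        [forall e in D, ~~ meets_interior e [set a; b; c; d]]]].

(* Main.v *)
(** A pair of vertices x < y of the polygon encodes the interval [x, y) of values.
    Sides encode the singletons and the full interval, which belong to every
    interval poset, so a dissection is the family of the remaining intervals.
    Being diagonally framed means that overlapping members X, Y come with
    X :&: Y, X :|: Y, X :\: Y and Y :\: X; given this, having no quadrilateral means
    that if three consecutive members have their union in the family, so do two
    adjacent ones of them.  Interval posets have both properties.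

    Conversely, an order of positions whose blocks are exactly a given family is
    built recursively.  If the range is the union of two adjacent members, cut it
    at the least such point and concatenate the two parts, the orientations being
    chosen so that no unwanted block appears across the cut.  Otherwise the maximal
    proper members partition the range into k parts; k = 2 would be a cut, k = 3 is
    the quadrilateral case, and for k >= 4 the parts are ordered by a simple
    permutation of length k. *)
Require Import Defs.
From mathcomp Require Import all_boot all_fingroup zify.

Set Implicit Arguments.
Unset Strict Implicit.
Unset Printing Implicit Defensive.

Local Notation relP F := (fun x y => is_true (F x y)).

(** * Blocks of a linear order *)

Definition inj_on (f : nat -> nat) a b :=
  forall u v, a <= u < b -> a <= v < b -> f u = f v -> u = v.

(* [f] lists the values of [a, b) in the order of their positions [f u]: no value
   of [a, b) outside [x, y) is placed between two values of [x, y). *)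
Definition block (f : nat -> nat) a b x y :=
  forall u v z, x <= u < y -> x <= v < y -> a <= z < b ->
    f u < f z -> f z < f v -> x <= z < y.

Definition framed (F : nat -> nat -> Prop) (lo hi : nat) :=
  forall x x' y y', lo <= x -> x < x' -> x' < y -> y < y' -> y' <= hi ->
    F x y -> F x' y' -> [/\ F x x', F x' y, F y y' & F x y'].

(* In a framed family the diagonals of a quadrilateral are the only members that
   matter: a member crossing any of its sides forces one of them, see
   [quad_split_of_cross]. *)
Definition quad_split (F : nat -> nat -> Prop) (lo hi : nat) :=
  forall a b c d, lo <= a -> a < b -> b < c -> c < d -> d <= hi ->
    F a b -> F b c -> F c d -> F a d -> F a c \/ F b d.

Lemma inj_on_neq f a b u v : inj_on f a b ->
  a <= u < b -> a <= v < b -> u <> v -> f u < f v \/ f v < f u.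
Proof.
move=> fi hu hv uv; case: (ltngtP (f u) (f v)) => [||/(fi u v hu hv)//]; by [left|right].
Qed.

(** For [[x, x')]: if an overlap value [z] is placed between [u] and [v], there is no place left for
    [y], which is in the second block only. Before [u] or after [v] it draws that value into the
    second block; between them it falls into the first. [[y, y')] is symmetric, with [x] for [y]. In
    the union, [z] lies between the common value [x'] and one of [u], [v]. *)
Lemma block_framed f a b : inj_on f a b -> framed (block f a b) a b.
Proof.
move=> fi x x' y y' ax xx' x'y yy' y'b B B'.
have ne u v := @inj_on_neq f a b u v fi.
split=> u v z hu hv hz uz zv.
- have zX : x <= z < y by apply: (B u v) => //; lia.
  case: (ltnP z x') => [|zx']; first lia.
  have [yu|uy] := ne y u ltac:(lia) ltac:(lia) ltac:(lia).
    have := B' y z u ltac:(lia) ltac:(lia) ltac:(lia) yu uz; lia.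
  have [yv|vy] := ne y v ltac:(lia) ltac:(lia) ltac:(lia).
    have := B u v y ltac:(lia) ltac:(lia) ltac:(lia) uy yv; lia.
  have := B' z y v ltac:(lia) ltac:(lia) ltac:(lia) zv vy; lia.
- have := B u v z ltac:(lia) ltac:(lia) hz uz zv.
  have := B' u v z ltac:(lia) ltac:(lia) hz uz zv; lia.
- have zX : x' <= z < y' by apply: (B' u v) => //; lia.
  case: (ltnP z y) => [zx'|]; last lia.
  have [yu|uy] := ne x u ltac:(lia) ltac:(lia) ltac:(lia).
    have := B x z u ltac:(lia) ltac:(lia) ltac:(lia) yu uz; lia.
  have [yv|vy] := ne x v ltac:(lia) ltac:(lia) ltac:(lia).
    have := B' u v x ltac:(lia) ltac:(lia) ltac:(lia) uy yv; lia.
  have := B z x v ltac:(lia) ltac:(lia) ltac:(lia) zv vy; lia.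
- case: (z =P x') => [|zx']; first lia.
  have [zx|xz] := ne z x' hz ltac:(lia) zx'.
    case: (ltnP u y) => uy.
      have := B u x' z ltac:(lia) ltac:(lia) hz uz zx; lia.
    have := B' u x' z ltac:(lia) ltac:(lia) hz uz zx; lia.
  case: (ltnP v y) => vy.
    have := B x' v z ltac:(lia) ltac:(lia) hz xz zv; lia.
  have := B' x' v z ltac:(lia) ltac:(lia) hz xz zv; lia.
Qed.

(** Lexicographic order, by [l] (the part) and then by [h] (the place within the part), as a single
    number; below [b] a base [N] above all [h u] exists. *)
Lemma bounded_order_glue b (l h : nat -> nat) :
  exists f : nat -> nat, forall u v, u < b -> v < b ->
    (f u < f v) = (l u < l v) || (l u == l v) && (h u < h v).
Proof.
pose N := (\max_(u < b) h u).+1.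
have hN u : u < b -> h u < N.
  by move=> ub; rewrite ltnS (leq_bigmax (Ordinal ub)).
exists (fun u => l u * N + h u) => u v /hN hu /hN hv.
case: (ltngtP (l u) (l v)) => [luv|luv|->] /=; last by rewrite ltn_add2l.
- by apply/idP; nia.
- by apply/negbTE; rewrite -leqNgt; nia.
Qed.

(* A simple permutation of 0, ..., k-1 for k >= 4: the odd values in increasing
   order, then 0, then k-1 if it is even, then the remaining even values. *)
Definition simple_pos k v :=
  if odd v then v else if v == k.-1 then if v == 0 then k else k.+1 else k + v.

Lemma simple_pos_inj k : inj_on (simple_pos k) 0 k.
Proof. by move=> u v; rewrite /simple_pos /=; do ?case: ifP; lia. Qed.

(** [0] is placed between the odd values and the other even ones, and the block has two consecutive
    values, so [i = 0]. Now [0] and [1] are in the block, and all larger odd values are placed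
    between them. For odd [k] this brings in [k - 2], so [2] is there as well, and [k - 1] is placed
    between [0] and [2]. *)
Lemma simple_pos_block k i j : 4 <= k -> i < j -> j < k ->
  block (simple_pos k) 0 k i j.+1 -> i = 0 /\ j = k.-1.
Proof.
move=> k4 ij jk B.
have P u v z : i <= u <= j -> i <= v <= j -> z < k ->
    simple_pos k u < simple_pos k z -> simple_pos k z < simple_pos k v -> i <= z <= j.
  by move=> hu hv hz uz zv; exact: (B u v z hu hv hz uz zv).
have P0 u v : i <= u <= j -> i <= v <= j -> odd u -> ~~ odd v -> v <> 0 -> i = 0.
  move=> hu hv ou ev v0; apply/eqP; rewrite -leqn0.
  suff: i <= 0 <= j by lia.
  by apply: (P u v) => //; rewrite /simple_pos /=; do ?case: ifP; lia.
have i0 : i = 0.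
  case: (i =P 0) => // i0; have [oi|oi] := boolP (odd i).
    by apply: (P0 i i.+1) => //=; lia.
  by apply: (P0 i.+1 i) => //=; lia.
split=> //; subst i; case: (j =P k.-1) => // jk'.
have [ok|ok] := boolP (odd k); last first.
  suff: 0 <= k.-1 <= j by lia.
  by apply: (P 1 0); rewrite /simple_pos /=; do ?case: ifP; lia.
have [jk2|jk2] := leqP j.+1 k.-2.
  suff: 0 <= k.-2 <= j by lia.
  by apply: (P 1 0); rewrite /simple_pos /=; do ?case: ifP; lia.
suff: 0 <= k.-1 <= j by lia.
by apply: (P 0 2); rewrite /simple_pos /=; do ?case: ifP; lia.
Qed.

(** * Finite chains of cut points *)

Lemma chain_exists (T : nat -> nat -> Prop) a b : a <= b ->
  (forall x, a <= x < b -> exists y, [/\ x < y, y <= b & T x y]) ->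
  exists p k, [/\ p 0 = a, p k = b & forall i, i < k -> p i < p i.+1 /\ T (p i) (p i.+1)].
Proof.
move=> ab step.
suff H m x : b - x < m -> a <= x <= b ->
    exists p k, [/\ p 0 = x, p k = b & forall i, i < k -> p i < p i.+1 /\ T (p i) (p i.+1)].
  by apply: (H (b - a).+1); lia.
elim: m x => [|m IH] x // xm hx.
have [xb|xb] := eqVneq x b; first by exists (fun=> b), 0; split.
have [y [xy yb Txy]] := step x ltac:(lia).
have [p [k [p0 pk pS]]] := IH y ltac:(lia) ltac:(lia).
exists (fun i => if i is i'.+1 then p i' else x), k.+1; split=> // -[|i] ik.
  by rewrite p0.
exact: pS.
Qed.

Lemma finite_choice (A : Type) (P : nat -> A -> Prop) (a0 : A) k :
  (forall i, i < k -> exists g, P i g) -> exists g, forall i, i < k -> P i (g i).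
Proof.
elim: k => [|k IH] H; first by exists (fun=> a0).
have [g hg] := IH (fun i ik => H i (ltnW ik)).
have [c hc] := H k (ltnSn k).
exists (fun i => if i == k then c else g i) => i; rewrite ltnS leq_eqVlt.
by case: eqP => [-> //|_ /=]; apply: hg.
Qed.

Lemma chain_mono p k : (forall i, i < k -> p i < p i.+1) ->
  forall i j, i <= j -> j <= k -> p i <= p j.
Proof.
move=> pS i; elim=> [|j IH]; first by rewrite leqn0 => /eqP->.
rewrite leq_eqVlt => /orP[/eqP-> //|ij jk].
by have := pS j jk; have := IH ij (ltnW jk); lia.
Qed.

Lemma chain_index p k : (forall i, i < k -> p i < p i.+1) ->
  exists idx : nat -> nat, forall u, p 0 <= u < p k ->
    [/\ idx u < k, p (idx u) <= u & u < p (idx u).+1].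
Proof.
move=> pS; exists (fun u => find (fun i => u < p i.+1) (iota 0 k)) => u /andP[u0 uk].
set i := find _ _.
have hasu : has (fun i => u < p i.+1) (iota 0 k).
  apply/hasP; exists k.-1; first by rewrite mem_iota; case: (k) u0 uk; lia.
  by case: (k) u0 uk => //=; lia.
have ik : i < k by rewrite -[X in _ < X](size_iota 0 k) -has_find.
split=> //; last by have := nth_find 0 hasu; rewrite nth_iota.
case E : i => [|j] //.
have := before_find 0 (a := fun i => u < p i.+1) (s := iota 0 k) (i := j).
rewrite -/i E nth_iota; last lia.
by move=> /(_ (ltnSn j)); rewrite add0n; lia.
Qed.

(** * Disjoint blocks and quadrilaterals *)

(** Disjoint blocks never interleave, so one comparison decides all of them and the least values can
    stand for the blocks. *)
Lemma block_lt f lo hi x y x' y' u w : inj_on f lo hi ->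
  lo <= x -> y <= x' \/ y' <= x -> y <= hi -> lo <= x' -> y' <= hi ->
  block f lo hi x y -> block f lo hi x' y' ->
  x <= u < y -> x' <= w < y' -> f u < f w -> f x < f x'.
Proof.
move=> fi lx dis yh lx' yh' B B' hu hw uw.
have ne := inj_on_neq fi.
have [//|x'x] := ne x x' ltac:(lia) ltac:(lia) ltac:(lia).
have [ux'|x'u] := ne u x' ltac:(lia) ltac:(lia) ltac:(lia).
  by have := B u x x' ltac:(lia) ltac:(lia) ltac:(lia) ux' x'x; lia.
by have := B' x' w u ltac:(lia) ltac:(lia) ltac:(lia) x'u uw; lia.
Qed.

(** If the third block is placed between the first two, it is next to the second and [[b, d)] is a
    block; otherwise nothing separates the first two and [[a, c)] is one. *)
Lemma block_quad_split f lo hi : inj_on f lo hi -> quad_split (block f lo hi) lo hi.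
Proof.
move=> fi a b c d la ab bc cd dh Bab Bbc Bcd Bad.
have lt_ab u w : a <= u < b -> b <= w < c -> f u < f w -> f a < f b.
  by apply: (block_lt fi _ _ _ _ _ Bab Bbc); lia.
have lt_ba u w : b <= u < c -> a <= w < b -> f u < f w -> f b < f a.
  by apply: (block_lt fi _ _ _ _ _ Bbc Bab); lia.
have lt_bc u w : b <= u < c -> c <= w < d -> f u < f w -> f b < f c.
  by apply: (block_lt fi _ _ _ _ _ Bbc Bcd); lia.
have lt_cb u w : c <= u < d -> b <= w < c -> f u < f w -> f c < f b.
  by apply: (block_lt fi _ _ _ _ _ Bcd Bbc); lia.
have lt_ac u w : a <= u < b -> c <= w < d -> f u < f w -> f a < f c.
  by apply: (block_lt fi _ _ _ _ _ Bab Bcd); lia.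
have lt_ca u w : c <= u < d -> a <= w < b -> f u < f w -> f c < f a.
  by apply: (block_lt fi _ _ _ _ _ Bcd Bab); lia.
case: (boolP (((f a < f c) && (f c < f b)) || ((f b < f c) && (f c < f a)))) => H.
  right=> u v z hu hv hz uz zv.
  have zad := Bad u v z ltac:(lia) ltac:(lia) hz uz zv.
  case: (ltnP z b) => zb; last lia.
  case: (ltnP u c) (ltnP v c) => uc [] vc.
  - by have := Bbc u v z ltac:(lia) ltac:(lia) hz uz zv; lia.
  - by have := lt_ba u z ltac:(lia) ltac:(lia) uz; have := lt_ac z v ltac:(lia) ltac:(lia) zv; lia.
  - by have := lt_ca u z ltac:(lia) ltac:(lia) uz; have := lt_ab z v ltac:(lia) ltac:(lia) zv; lia.
  - by have := Bcd u v z ltac:(lia) ltac:(lia) hz uz zv; lia.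
left=> u v z hu hv hz uz zv.
have zad := Bad u v z ltac:(lia) ltac:(lia) hz uz zv.
case: (ltnP z c) => zb; first lia.
case: (ltnP u b) (ltnP v b) => uc [] vc.
- by have := Bab u v z ltac:(lia) ltac:(lia) hz uz zv; lia.
- by have := lt_ac u z ltac:(lia) ltac:(lia) uz; have := lt_cb z v ltac:(lia) ltac:(lia) zv; lia.
- by have := lt_bc u z ltac:(lia) ltac:(lia) uz; have := lt_ca z v ltac:(lia) ltac:(lia) zv; lia.
- by have := Bbc u v z ltac:(lia) ltac:(lia) hz uz zv; lia.
Qed.

(** For [y < b], [[b, d)] is [[y, d)] minus [[a, b)]. For [b < y < c], [[a, c)] is the union of
    [[a, y)] and [[b, c)]; for [c < y] it is [[a, y)] minus [[c, d)]. *)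
Lemma quad_split_of_split (F : rel nat) n a b c d y :
  framed (relP F) 0 n -> a < b -> b < c -> c < d -> d <= n ->
  F a b -> F b c -> F c d -> a < y -> y < d -> F a y -> F y d -> F a c \/ F b d.
Proof.
move=> fF ab bc cd dn Fab Fbc Fcd ay yd Fay Fyd.
case: (ltngtP y b) => [yb|by_|yb]; last by right; rewrite -yb.
  by right; have [] := fF a y b d (leq0n _) ay yb ltac:(lia) dn Fab Fyd.
left; case: (ltngtP y c) => [yc|cy|<-//].
  by have [] := fF a b y c (leq0n _) ab by_ yc ltac:(lia) Fay Fbc.
by have [] := fF a c y d (leq0n _) ltac:(lia) cy yd dn Fay Fcd.
Qed.

(** Any two vertices are allowed as [p], [q], which treats sides and diagonals together. A member
    reaching outside [[a, d)] overlaps it and splits it. One that stays inside is turned, by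
    overlaps with the three pieces, into a member from [a] that ends past [b] or from [b] that ends
    past [c]. *)
Lemma quad_split_of_cross (F : rel nat) n a b c d x y p q :
  framed (relP F) 0 n -> a < b -> b < c -> c < d -> d <= n ->
  F a b -> F b c -> F c d -> F a d -> F x y -> y <= n ->
  [|| p == a, p == b, p == c | p == d] -> [|| q == a, q == b, q == c | q == d] ->
  [&& x < p, p < y & y < q] || [&& p < x, x < q & q < y] ->
  F a c \/ F b d.
Proof.
move=> fF ab bc cd dn Fab Fbc Fcd Fad Fxy yn hp hq hx.
have xy : x < y by lia.
have S t : a < t -> t < d -> F a t -> F t d -> F a c \/ F b d.
  exact: quad_split_of_split fF ab bc cd dn Fab Fbc Fcd.
have [xa|ax] := ltnP x a.
  have [F1 F2 F3 F4] := fF x a y d (leq0n _) xa ltac:(lia) ltac:(lia) dn Fxy Fad.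
  by apply: (S y) => //; lia.
have [dy|yd] := ltnP d y.
  have [F1 F2 F3 F4] := fF a x d y (leq0n _) ltac:(lia) ltac:(lia) dy yn Fad Fxy.
  by apply: (S x) => //; lia.
have right_of t : F b t -> c < t -> t <= d -> F b d.
  move=> Fbt ct; rewrite leq_eqVlt => /orP[/eqP <- //|td].
  by have [] := fF b c t d (leq0n _) bc ct td dn Fbt Fcd.
have left_of t : F a t -> b < t -> t < d -> F a c.
  move=> Fat bt td; case: (ltngtP t c) => [tc|ct|<-//].
    by have [] := fF a b t c (leq0n _) ab bt tc ltac:(lia) Fat Fbc.
  by have [] := fF a c t d (leq0n _) ltac:(lia) ct td dn Fat Fcd.
have [xb|bx] := ltnP x b.
  have by_ : b < y by lia.
  have [xa|xa] := eqVneq x a.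
    by left; apply: (left_of y) => //; [rewrite -xa|lia].
  have [F1 F2 F3 F4] := fF a x b y (leq0n _) ltac:(lia) xb by_ yn Fab Fxy.
  have [yE|yE] := eqVneq y d; first by right; rewrite -yE.
  by left; apply: (left_of y) => //; lia.
right; apply: (right_of y); try lia.
have [<-//|xb] := eqVneq x b.
by have [] := fF b x c y (leq0n _) ltac:(lia) ltac:(lia) ltac:(lia) yn Fbc Fxy.
Qed.

Lemma set2_eqP (T : finType) (a b c d : T) :
  [set a; b] = [set c; d] -> (a = c /\ b = d) \/ (a = d /\ b = c).
Proof.
move=> e; have := set21 c d; have := set22 c d; rewrite -e !inE.
have := set21 a b; have := set22 a b; rewrite {}e !inE.
by move=> /orP[]/eqP ? /orP[]/eqP ? /orP[]/eqP ? /orP[]/eqP ?; subst; by [left|right].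
Qed.

(** * Realizing a framed family *)

Definition realizes (F : rel nat) a b f :=
  inj_on f a b /\
  (forall x y, a <= x -> x < y -> y <= b -> F x y <-> block f a b x y).

(** A cut of [[a, b)] into two members can be placed in two ways; [up] puts the lower part first.
    All cuts must agree, which controls the blocks that arise when the order is concatenated with
    another one. *)
Definition splits_oriented (up : bool) (F : rel nat) a b (f : nat -> nat) :=
  forall c, F a c -> F c b -> forall u v, a <= u < c -> c <= v < b ->
    if up then f u < f v else f v < f u.

(** Reversal preserves blocks; [N] exceeds all positions, so the truncated subtraction is strictly
    decreasing. *)
Lemma realizes_rev F a b f up : realizes F a b f -> splits_oriented up F a b f ->
  exists2 g, realizes F a b g & splits_oriented (~~ up) F a b g.
Proof.
move=> [fi fb] fs; pose N := (\max_(u < b) f u).+1.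
have hN u : u < b -> f u < N.
  by move=> ub; rewrite ltnS (leq_bigmax (Ordinal ub)).
exists (fun u => N - f u); last first.
  move=> c ac cb u v hu hv; have := fs c ac cb u v hu hv.
  by have := hN v ltac:(lia); have := hN u ltac:(lia); case: (up) => /=; lia.
split=> [u v hu hv|x y ax xy yb].
  move=> e; apply: fi => //.
  by have := hN u ltac:(lia); have := hN v ltac:(lia); lia.
rewrite fb //; split=> B u v z hu hv hz uz zv.
all: have hNu := hN u ltac:(lia).
all: have hNv := hN v ltac:(lia).
all: have hNz := hN z ltac:(lia).
all: by apply: (B v u z) => //; lia.
Qed.

(* As [c] is least, no split point of [a, c) splits [a, b), hence the opposite
   orientation on [a, c).  The split points of [c, b) either all split [a, b), in
   which case [up] holds, or none does. *)
Lemma realize_sum (F : rel nat) a b c up f1 f2 :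
  framed (relP F) a b -> a < c -> c < b ->
  F a b -> F a c -> F c b ->
  (forall d, a < d < b -> F a d -> F d b -> c <= d) ->
  realizes F a c f1 -> splits_oriented false F a c f1 ->
  (forall d, c < d < b -> F c d -> F d b -> F a d = up) ->
  realizes F c b f2 -> splits_oriented up F c b f2 ->
  exists2 f, realizes F a b f & splits_oriented true F a b f.
Proof.
move=> fF ac cb Fab Fac Fcb cmin [f1i f1b] f1s Fup [f2i f2b] f2s.
have [f fE] := bounded_order_glue b (fun u => nat_of_bool (c <= u))
  (fun u => if u < c then f1 u else f2 u).
have fE1 u v : u < c -> v < c -> (f u < f v) = (f1 u < f1 v).
  move=> uc vc; rewrite fE /=; try lia.
  by rewrite !(leqNgt c) uc vc.
have fE2 u v : c <= u < b -> c <= v < b -> (f u < f v) = (f2 u < f2 v).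
  move=> uc vc; rewrite fE /=; try lia.
  by rewrite !(leqNgt c) !ifN; lia.
have fE12 u v : u < c -> c <= v < b -> f u < f v.
  by move=> uc vc; rewrite fE /=; lia.
clear fE.
have fi : inj_on f a b.
  move=> u v hu hv e; case: (ltnP u c) (ltnP v c) => uc [] vc.
  - by apply: f1i; try lia; have := fE1 u v uc vc; have := fE1 v u vc uc; lia.
  - by have := fE12 u v uc ltac:(lia); lia.
  - by have := fE12 v u vc ltac:(lia); lia.
  by apply: f2i; try lia; have := fE2 u v ltac:(lia) ltac:(lia);
     have := fE2 v u ltac:(lia) ltac:(lia); lia.
have L x y : a <= x -> y <= c -> block f1 a c x y <-> block f a b x y.
  move=> ax yc; split=> B u v z hu hv hz uz zv.
    case: (ltnP z c) => zc; last by have := fE12 v z ltac:(lia) ltac:(lia); lia.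
    by apply: (B u v z) => //; rewrite -?fE1 //; lia.
  by apply: (B u v z) => //; rewrite ?fE1 //; lia.
have R x y : c <= x -> y <= b -> block f2 c b x y <-> block f a b x y.
  move=> ax yc; split=> B u v z hu hv hz uz zv.
    case: (leqP c z) => zc; last by have := fE12 z u ltac:(lia) ltac:(lia); lia.
    by apply: (B u v z) => //; rewrite -?fE2 //; lia.
  by apply: (B u v z) => //; rewrite ?fE2 //; lia.
(* A member [[a, d)] with [c < d < b] overlaps [[c, b)], so [d] splits both [[c, b)] and
   [[a, b)]. *)
have Fdown d : c < d < b -> F a d -> up /\ F c d /\ F d b.
  move=> /andP[cd db] Fad.
  have [_ Fcd Fdb _] := fF a c d b (leqnn a) ac cd db (leqnn b) Fad Fcb.
  by have := Fup d _ Fcd Fdb; rewrite cd db => /(_ isT); rewrite Fad => <-.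
exists f; last first.
  move=> d Fad Fdb u v hu hv.
  have := cmin d ltac:(lia) Fad Fdb.
  rewrite leq_eqVlt => /orP[/eqP ?|cd]; first by subst d; apply: fE12; lia.
  have [upT [Fcd _]] := Fdown d ltac:(lia) Fad.
  case: (ltnP u c) => uc; first by apply: fE12; lia.
  have hu' : c <= u < d by lia.
  rewrite fE2; try lia.
  by have := f2s d Fcd Fdb u v hu' hv; rewrite upT.
split=> // x y ax xy yb.
case: (leqP y c) => yc; first by rewrite -L // f1b.
case: (leqP c x) => cx; first by rewrite -R // f2b.
split=> [Fxy|B].
  (* If [a < x], then [x < c] would split [[a, b)], against the minimality of [c]. *)
  have [xa|xa] := ltnP a x.
    have [Fax Fxc _ Fay] := fF a x c y (leqnn a) xa cx yc yb Fac Fxy.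
    have xab : a < x < b by rewrite xa (ltn_trans cx cb).
    suff Fxb : F x b by have := cmin x xab Fax Fxb; rewrite leqNgt cx.
    move: yb; rewrite leq_eqVlt => /orP[/eqP<- //|yb'].
    by have [] := fF x c y b (ltnW xa) cx yc yb' (leqnn b) Fxy Fcb.
  have xE : x = a by lia.
  subst x; have [->|yb'] := eqVneq y b; first by move=> u v z *; lia.
  have [upT [Fcy Fyb]] := Fdown y ltac:(lia) Fxy.
  move=> u v z hu hv hz uz zv; case: (ltnP z y) => zy; first lia.
  have [vc|vc] := ltnP v c.
    have vz : f v < f z by apply: fE12; lia.
    by move: zv; rewrite ltnNge (ltnW vz).
  have vy : c <= v < y by lia.
  have yz : y <= z < b by lia.
  by have := f2s y Fcy Fyb v z vy yz; rewrite upT -fE2; lia.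
have Bac : block f a b a c by rewrite -L // -f1b.
have Bcb : block f a b c b by rewrite -R // -f2b.
have BO := block_framed fi.
have [xa|xa] := ltnP a x.
  (* Here [x] splits [[a, c)], and the descending orientation places [a] between [x] and [c], which
     are in the block while [a] is not. *)
  have [Bax Bxc _ _] := BO a x c y ltac:(lia) ltac:(lia) ltac:(lia) ltac:(lia) ltac:(lia) Bac B.
  have Fax : F a x by rewrite f1b ?L //; lia.
  have Fxc : F x c by rewrite f1b ?L //; lia.
  have := f1s x Fax Fxc a x ltac:(lia) ltac:(lia) => /= xa'.
  have := B x c a ltac:(lia) ltac:(lia) ltac:(lia).
  by rewrite fE1 ?fE12; lia.
have xE : x = a by lia.
subst x; have [-> //|yb'] := eqVneq y b.
have [_ Bcy Byb _] := BO a c y b ltac:(lia) ltac:(lia) ltac:(lia) ltac:(lia) ltac:(lia) B Bcb.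
have Fcy : F c y by rewrite f2b ?R //; lia.
have Fyb : F y b by rewrite f2b ?R //; lia.
(* Without [F a y] the orientation of [[c, b)] is descending, and [y] is placed between [a] and
   [c]. *)
have := Fup y ltac:(lia) Fcy Fyb; case: (up) f2s => // f2s _.
have := f2s y Fcy Fyb c y ltac:(lia) ltac:(lia) => /= yc'.
have := B a c y ltac:(lia) ltac:(lia) ltac:(lia).
by rewrite (fE12 a y) ?(fE2 y c); lia.
Qed.

(** From each left end the longest member other than the whole is taken; singletons ensure that
    there is one. A member leaving its part to the right overlaps it. The union is then longer than
    the longest, or it is everything and [x] splits [[a, b)]. *)
Lemma maximal_blocks (F : rel nat) a b :
  framed (relP F) a b -> a.+1 < b -> F a b ->
  (forall x, a <= x < b -> F x x.+1) ->
  (forall c, a < c < b -> F a c -> ~~ F c b) ->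
  exists p k,
    [/\ p 0 = a, p k = b, forall i, i < k -> p i < p i.+1,
        forall i, i < k -> F (p i) (p i.+1) /\ ~ (p i = a /\ p i.+1 = b) &
        forall x y, a <= x -> x < y -> y <= b -> F x y ->
          (x = a /\ y = b) \/ exists i, [/\ i < k, p i <= x & y <= p i.+1]].
Proof.
move=> fF ab Fab F1 nosplit.
pose T x y := [/\ F x y, ~ (x = a /\ y = b) &
  forall y', x < y' -> y' <= b -> F x y' -> ~ (x = a /\ y' = b) -> y' <= y].
have step x : a <= x < b -> exists y, [/\ x < y, y <= b & T x y].
  move=> hx; pose P y := [&& x < y, y <= b, F x y & ~~ ((x == a) && (y == b))].
  have exP : exists y, P y by exists x.+1; rewrite /P F1 //; lia.
  have ubP y : P y -> y <= b by case/and4P.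
  have [y /and4P[xy yb Fxy nab] ymax] := ex_maxnP exP ubP.
  exists y; split=> //; split=> //; first by lia.
  by move=> y' xy' y'b Fxy' nab'; apply: ymax; rewrite /P xy' y'b Fxy' /=; lia.
have [p [k [p0 pk pS]]] := chain_exists (ltnW (ltnW ab)) step.
have pS1 i : i < k -> p i < p i.+1 by move=> /pS[].
have pM := chain_mono pS1.
exists p, k; split=> //; first by move=> i /pS[_ []].
move=> x y ax xy yb Fxy.
case: (boolP ((x == a) && (y == b))) => [/andP[/eqP-> /eqP->]|nab]; [by left|right].
have [idx hidx] := chain_index pS1.
have [ik pix xpi] := hidx x ltac:(lia).
exists (idx x); split=> //.
move: (idx x) ik pix xpi => i ik pix xpi {idx hidx}.
have [lt_pi [Fi nabi maxi]] := pS i ik.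
have api : a <= p i by rewrite -p0; apply: pM; lia.
have pib : p i.+1 <= b by rewrite -pk; apply: pM.
have [pxi|pxi] := eqVneq (p i) x.
  by rewrite -pxi in Fxy xy nab; apply: maxi => //; lia.
case: (leqP y (p i.+1)) => // piy; exfalso.
have [F1' F2' F3' F4'] := fF (p i) x (p i.+1) y api ltac:(lia) xpi piy yb Fi Fxy.
case: (boolP ((p i == a) && (y == b))) => [/andP[/eqP ea /eqP eb]|nab'].
  have /negP := nosplit x ltac:(lia) ltac:(by rewrite -ea).
  by apply; rewrite -eb.
have := maxi y ltac:(lia) yb F4' ltac:(lia); lia.
Qed.

Lemma realize_prime (F : rel nat) a b :
  framed (relP F) a b -> quad_split (relP F) a b -> a.+1 < b -> F a b ->
  (forall x, a <= x < b -> F x x.+1) ->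
  (forall c, a < c < b -> F a c -> ~~ F c b) ->
  (forall x y, a <= x -> x < y -> y <= b -> y - x < b - a -> F x y ->
     exists g, realizes F x y g) ->
  exists f, realizes F a b f.
Proof.
move=> fF qF ab Fab F1 nosplit IH.
have [p [k [p0 pk pS pF pmax]]] := maximal_blocks fF ab Fab F1 nosplit.
have pM := chain_mono pS.
have k4 : 4 <= k.
  case: k p0 pk pS pF pM {pmax} => [|[|[|[|k]]]] // p0 pk pS pF pM; exfalso.
  - by lia.
  - by have [_ []] := pF 0 isT.
  - have [F0 _] := pF 0 isT; have [F1' _] := pF 1 isT.
    rewrite p0 in F0; rewrite pk in F1'.
    have := pS 0 isT; have := pS 1 isT; rewrite p0 pk => l1 l0.
    by have := nosplit (p 1) ltac:(lia) F0; rewrite F1'.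
  - have [F0 _] := pF 0 isT; have [F1' _] := pF 1 isT; have [F2 _] := pF 2 isT.
    rewrite p0 in F0; rewrite pk in F2.
    have := pS 0 isT; have := pS 1 isT; have := pS 2 isT; rewrite p0 pk => l2 l1 l0.
    have [Fc|Fc] := qF a (p 1) (p 2) b ltac:(lia) l0 l1 l2 ltac:(lia) F0 F1' F2 Fab.
      by have := nosplit (p 2) ltac:(lia) Fc; rewrite F2.
    by have := nosplit (p 1) ltac:(lia) F0; rewrite Fc.
have pa i : i <= k -> a <= p i by move=> ik; rewrite -p0; apply: pM.
have pb i : i <= k -> p i <= b by move=> ik; rewrite -pk; apply: pM.
have [g hg] : exists g, forall i, i < k -> realizes F (p i) (p i.+1) (g i).
  apply: (finite_choice (P := fun i h => realizes F (p i) (p i.+1) h) id) => i ik.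
  have [Fi nab] := pF i ik.
  have := pa i ltac:(lia); have := pb i.+1 ltac:(lia); have := pS i ik.
  by move=> l1 l2 l3; apply: IH => //; lia.
have [idx hidx0] := chain_index pS.
have hidx u : a <= u < b -> [/\ idx u < k, p (idx u) <= u & u < p (idx u).+1].
  by rewrite -p0 -pk; apply: hidx0.
have idxE u i : i < k -> p i <= u < p i.+1 -> idx u = i.
  move=> ik hu; have [] := hidx u; first by have := pa i; have := pb i.+1; lia.
  move=> lk l1 l2; have := pM (idx u).+1 i; have := pM i.+1 (idx u); lia.
have idx_mono u v : a <= u -> u <= v -> v < b -> idx u <= idx v.
  move=> au uv vb; have [l1 l2 l3] := hidx u ltac:(lia); have [m1 m2 m3] := hidx v ltac:(lia).
  by have := pM (idx v).+1 (idx u); lia.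
clear hidx0.
have [f fE] := bounded_order_glue b (fun u => simple_pos k (idx u)) (fun u => g (idx u) u).
have fE_same u v : u < b -> v < b -> idx u = idx v ->
    (f u < f v) = (g (idx u) u < g (idx u) v).
  by move=> ub vb e; rewrite fE // e ltnn eqxx.
have fE_neq u v : a <= u < b -> a <= v < b -> idx u <> idx v ->
    (f u < f v) = (simple_pos k (idx u) < simple_pos k (idx v)).
  move=> hu hv e; rewrite fE; try lia; case: eqP => [e'|]; last by rewrite orbF.
  have [uk _ _] := hidx u hu; have [vk _ _] := hidx v hv.
  by case: e; apply: (simple_pos_inj (k := k)) => //; lia.
have fi : inj_on f a b.
  move=> u v hu hv e.
  have [uk up up'] := hidx u hu; have [vk vp vp'] := hidx v hv.
  have uv : (f u < f v) = false by rewrite e ltnn.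
  have vu : (f v < f u) = false by rewrite e ltnn.
  have [eI|neI] := idx u =P idx v.
    rewrite fE_same // in uv; try lia; rewrite fE_same // in vu; try lia.
    have [gi _] := hg _ uk; rewrite -eI in vp vp' vu; apply: gi; lia.
  rewrite fE_neq // in uv; rewrite fE_neq // in vu; last by move/esym.
  by case: neI; apply: (simple_pos_inj (k := k)) => //; lia.
have inside i x y : i < k -> p i <= x -> x < y -> y <= p i.+1 ->
    F x y <-> block f a b x y.
  move=> ik pix xy ypi; have [gi ->] := hg i ik; try lia.
  have api := pa i ltac:(lia); have pbi := pb i.+1 ltac:(lia).
  have idxi u : x <= u < y -> idx u = i by move=> hu; apply: idxE; lia.
  clear fF qF pmax IH pF pS pM nosplit F1.
  split=> B u v z hu hv hz uz zv; have iu := idxi u hu; have iv := idxi v hv.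
    have [ez|nz] := idx z =P i; last first.
      rewrite fE_neq in uz; [|lia|lia|by rewrite iu; apply/nesym].
      rewrite fE_neq in zv; [|lia|lia|by rewrite iv].
      by rewrite iu in uz; rewrite iv in zv; lia.
    have [_ l1 l2] := hidx z hz; rewrite ez in l1 l2.
    rewrite fE_same in uz; [|lia|lia|by rewrite iu].
    rewrite fE_same in zv; [|lia|lia|by rewrite iv].
    rewrite iu in uz; rewrite ez in zv.
    by apply: (B u v z) => //; lia.
  have ez : idx z = i by apply: idxE; lia.
  apply: (B u v z) => //; first by lia.
    by rewrite fE_same ?iu //; lia.
  by rewrite fE_same ?ez //; lia.
(* A block meeting several parts induces a block of the simple permutation on their indices, so it
   meets the first and the last part. *)
have quot x y : a <= x -> x < y -> y <= b -> block f a b x y -> idx x < idx y.-1 ->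
    idx x = 0 /\ idx y.-1 = k.-1.
  move=> ax xy yb B lxy.
  have [xk px px'] := hidx x ltac:(lia); have [yk py py'] := hidx y.-1 ltac:(lia).
  apply: simple_pos_block => // i j m hi hj hm.
  (* In an extreme part an end of the block is the representative, in any other part its first
     value. *)
  have rep i' : idx x <= i' < (idx y.-1).+1 -> exists2 u, x <= u < y & idx u = i'.
    move=> hi'; have [->|nx] := eqVneq i' (idx x); first by exists x => //; lia.
    have [->|ny] := eqVneq i' (idx y.-1); first by exists y.-1 => //; lia.
    exists (p i'); last by apply: idxE; [lia|have := pS i'; lia].
    by have := pM (idx x).+1 i'; have := pM i' (idx y.-1); lia.
  have [u hu <-] := rep i hi; have [v hv <-] := rep j hj => uz zv.
  have em : idx (p m) = m by apply: idxE; [lia|have := pS m; lia].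
  have hpm : a <= p m < b by have := pS m; have := pa m; have := pb m.+1; lia.
  have [eu|nu] := idx u =P m; first by rewrite eu ltnn in uz.
  have [ev|nv] := idx v =P m; first by rewrite ev ltnn in zv.
  have : x <= p m < y.
    apply: (B u v) => //; rewrite fE_neq ?em //; try lia.
  move=> hpm'; have := idx_mono x (p m); have := idx_mono (p m) y.-1; rewrite em; lia.
exists f; split=> // x y ax xy yb; split=> [Fxy|B].
  have [[-> ->]|[i [ik l1 l2]]] := pmax x y ax xy yb Fxy; first by move=> u v z *.
  by apply/(inside i).
have [xk px px'] := hidx x ltac:(lia); have [yk py py'] := hidx y.-1 ltac:(lia).
have := idx_mono x y.-1 ax ltac:(lia) ltac:(lia).
rewrite leq_eqVlt => /orP[/eqP e|lxy].
  by apply/(inside (idx x)) => //; rewrite e; lia.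
have [ex ey] := quot x y ax xy yb B lxy.
have BO := block_framed fi.
have Bblk i : i < k -> block f a b (p i) (p i.+1).
  by move=> ik; apply/(inside i) => //; [apply: pS|have [] := pF i ik].
rewrite ex p0 in px px'; rewrite ey in py; rewrite ey (@prednK k) ?pk in py'; last lia.
have l1 := pM 1 k.-1 ltac:(lia) ltac:(lia).
(* If the block started after [a], removing the first part would leave a block that begins in part
   [1], against [quot]. The other end is symmetric. *)
have xa : x = a.
  case: (ltnP a x) => [xa|]; last lia.
  have B0 := Bblk 0 ltac:(lia); rewrite p0 in B0.
  have [_ _ B1 _] := BO a x (p 1) y (leqnn a) xa px' ltac:(lia) yb B0 B.
  have e1 : idx (p 1) = 1 by apply: idxE; [lia|have := pS 1; lia].
  have := quot (p 1) y ltac:(lia) ltac:(lia) yb B1.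
  by rewrite e1 ey; lia.
have yb' : y = b.
  case: (ltnP y b) => [yb'|]; last lia.
  have B0 := Bblk k.-1 ltac:(lia); rewrite (@prednK k) ?pk in B0; last lia.
  have k2 : k.-2.+1 = k.-1 by lia.
  have lt2 := pS k.-2 ltac:(lia); rewrite k2 in lt2.
  have l2 := pM 1 k.-2 ltac:(lia) ltac:(lia).
  have [B1 _ _ _] := BO x (p k.-1) y b ax ltac:(lia) ltac:(lia) yb' (leqnn b) B B0.
  have e1 : idx (p k.-1).-1 = k.-2 by apply: idxE; [lia|rewrite k2; lia].
  have := quot x (p k.-1) ax ltac:(lia) ltac:(lia) B1.
  by rewrite e1 ex; lia.
by rewrite xa yb'.
Qed.

Lemma realize (F : rel nat) n :
  framed (relP F) 0 n -> quad_split (relP F) 0 n ->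
  (forall x, x < n -> F x x.+1) ->
  forall a b up, a < b -> b <= n -> F a b ->
  exists2 f, realizes F a b f & splits_oriented up F a b f.
Proof.
move=> fF qF F1 a b.
have [m] := ubnP (b - a); elim: m a b => // m IH a b bam up ab bn Fab.
suff [f rf sf] : exists2 f, realizes F a b f & splits_oriented true F a b f.
  by case: up; [exists f|apply: realizes_rev sf].
have fFab : framed (relP F) a b by move=> x x' y y' *; apply: fF => //; lia.
have qFab : quad_split (relP F) a b by move=> x x' y y' *; apply: qF => //; lia.
have [ba1|ba1] := leqP b a.+1.
  exists id; last by move=> c _ _ u v hu hv /=; lia.
  split=> // x y ax xy yb; have -> : x = a by lia.
  have -> : y = b by lia.
  by split=> // _ u v z *; lia.
pose S c := [&& a < c, c < b, F a c & F c b].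
case: (boolP (has S (iota 0 b))) => [hasS|/hasPn noS]; last first.
  have nosplit c : a < c < b -> F a c -> ~~ F c b.
    move=> hc Fac; have := noS c; rewrite mem_iota /S Fac; lia.
  have [||f rf] := realize_prime fFab qFab ba1 Fab _ nosplit.
  - by move=> x hx; apply: F1; lia.
  - move=> x y ax xy yb xyab Fxy.
    by have [||f rf _] := IH x y _ true xy _ Fxy; [lia|lia|exists f].
  exists f => // c Fac Fcb u v hu hv.
  by have := nosplit c ltac:(lia) Fac; rewrite Fcb.
have exS : exists c, S c by have /hasP[c _ Sc] := hasS; exists c.
have [c /and4P[ac cb Fac Fcb] cmin] := ex_minnP exS.
(* The orientation required on [[c, b)]: ascending exactly when some point above [c] splits
   [[a, b)]. *)
pose up2 := has (fun d => [&& c < d, F a d & F d b]) (iota 0 b).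
have [f1 r1 s1] := IH a c ltac:(lia) false ac ltac:(lia) Fac.
have [f2 r2 s2] := IH c b ltac:(lia) up2 cb bn Fcb.
apply: (realize_sum (c := c)) r1 s1 _ r2 s2 => //.
  by move=> d /andP[ad db] Fad Fdb; apply: cmin; rewrite /S ad db Fad.
(* If some [e > c] splits [[a, b)], every split point [d] of [[c, b)] gives a member [[a, d)]: for
   [d < e] it is [[a, e)] minus [[d, b)], for [e < d] the union of [[a, e)] and [[c, d)]. *)
move=> d /andP[cd db] Fcd Fdb; have ad := ltn_trans ac cd; apply/idP/hasP => [Fad|[e]].
  by exists d; rewrite ?mem_iota ?cd ?Fad //; lia.
rewrite mem_iota => /andP[_ eb] /and3P[ce Fae Feb].
case: (ltngtP d e) => [de|ed|->//].
  by have [] := fFab a d e b (leqnn a) ad de eb (leqnn b) Fae Fdb.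
by have [] := fFab a c e d (leqnn a) ac ce ed (ltnW db) Fae Fcd.
Qed.

(** * Dissections as families of intervals *)

Section Polygon.
Variable n : nat.
Implicit Types (D : {set {set 'I_n.+1}}) (e : {set 'I_n.+1}) (i j : 'I_n.+1).

Lemma card2_lt e : #|e| == 2 -> exists i j, i < j /\ e = [set i; j].
Proof.
move=> /cards2P[i [j [ij ->]]].
case: (ltngtP i j) => [lt|lt|/val_inj eq]; first by exists i, j.
  by exists j, i; rewrite setUC.
by rewrite eq eqxx in ij.
Qed.

Lemma is_side_lt i j : i < j ->
  is_side [set i; j] = (j == i.+1 :> nat) || (i == 0 :> nat) && (j == n :> nat).
Proof.
move=> ij; have jn := ltn_ord j.
rewrite /is_side cards2 neq_ltn ij /=.
have ordSE (k : 'I_n.+1) : ordS k = (if k.+1 == n.+1 then 0 else k.+1) :> nat.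
  have -> : ordS k = k.+1 %% n.+1 :> nat by [].
  case: eqP => [->|kn]; first by rewrite modnn.
  by rewrite modn_small //; have := ltn_ord k; lia.
apply/existsP/idP => [[k /eqP/set2_eqP[[ik jk]|[ik jk]]] |].
- by move: ij; rewrite ik jk ordSE; case: ifP; lia.
- by move: ij; rewrite ik jk ordSE; case: ifP; lia.
- case/orP=> [/eqP jE|/andP[/eqP iE /eqP jE]]; [exists i|exists j]; apply/eqP.
    by congr [set _; _]; apply: ord_inj; rewrite ordSE; case: ifP; lia.
  by rewrite setUC; congr [set _; _]; apply: ord_inj; rewrite ordSE; case: ifP; lia.
Qed.

Lemma crosses_lt i j (k l : 'I_n.+1) : i < j -> k < l ->
  crosses [set i; j] [set k; l] =
  [&& i < k, k < j & j < l] || [&& k < i, i < l & l < j].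
Proof.
move=> ij kl; apply/existsP/idP.
  case=> a /existsP[b /existsP[c /existsP[d /and4P[ab bc cd]]]].
  by case/orP=> /andP[/eqP/set2_eqP[][? ?] /eqP/set2_eqP[][? ?]]; subst; lia.
case/orP=> /and3P[h1 h2 h3].
  exists i; apply/existsP; exists k; apply/existsP; exists j; apply/existsP; exists l.
  by rewrite h1 h2 h3 !eqxx.
exists k; apply/existsP; exists i; apply/existsP; exists l; apply/existsP; exists j.
by rewrite h1 h2 h3 !eqxx orbT.
Qed.

Lemma crosses_neq e i j : crosses e [set i; j] -> i != j.
Proof.
case/existsP=> a /existsP[b /existsP[c /existsP[d /and4P[ab bc cd h]]]].
apply: contraTneq h => ->; apply/norP; split; apply/nandP; right;
  apply/eqP => /set2_eqP[][e1 e2].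
all: have := ltn_trans ab bc; have := ltn_trans bc cd.
all: by rewrite -e1 -e2 ltnn.
Qed.

(** Counting the sides restores the singletons and the whole range. [inord] sends numbers above [n]
    to [0], hence the bound on [y]. *)
Definition seg_rel D : rel nat :=
  fun x y => [&& x < y, y <= n & drawn D [set inord x; inord y]].

Lemma seg_rel_ord D i j : seg_rel D i j = (i < j) && drawn D [set i; j].
Proof.
have jn : j <= n by rewrite -ltnS.
by rewrite /seg_rel !inord_val jn.
Qed.

Lemma seg_relP D x y : seg_rel D x y ->
  exists i j, [/\ i = x :> nat, j = y :> nat, i < j & drawn D [set i; j]].
Proof.
case/and3P=> xy yn dr; exists (inord x), (inord y).
by rewrite !inordK //; lia.
Qed.

Lemma drawn_diagonal D i j : drawn D [set i; j] -> i.+1 < j ->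
  ~~ ((i == 0 :> nat) && (j == n :> nat)) -> [set i; j] \in D.
Proof.
move=> dr ij nij; case/orP: dr => //.
by rewrite is_side_lt; lia.
Qed.

Lemma dissectionP D e : is_dissection D -> e \in D ->
  exists i j, [/\ e = [set i; j], i < j, ~~ is_side e & seg_rel D i j].
Proof.
move=> /forall_inP dD eD; have /andP[c2 ns] := dD e eD.
have [i [j [ij eE]]] := card2_lt c2.
by exists i, j; rewrite seg_rel_ord ij /drawn -eE eD orbT.
Qed.

Lemma seg_rel_inj D D' : is_dissection D -> is_dissection D' ->
  (forall x y, seg_rel D x y = seg_rel D' x y) -> D = D'.
Proof.
move=> dD dD' e.
have sub E E' : is_dissection E -> (forall x y, seg_rel E x y = seg_rel E' x y) -> E \subset E'.
  move=> dE eq; apply/subsetP => f fE; have [i [j [fij ij ns]]] := dissectionP dE fE.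
  by rewrite eq seg_rel_ord ij /drawn -fij (negbTE ns).
by apply/eqP; rewrite eqEsubset !sub.
Qed.

Lemma diagonally_framedP D : is_dissection D ->
  diagonally_framed D <-> framed (relP (seg_rel D)) 0 n.
Proof.
move=> dD; split=> [fD x x' y y' _ xx' x'y yy' y'n Fxy Fxy'|fD].
  have [i [j [iE jE ij dij]]] := seg_relP Fxy.
  have [i' [j' [iE' jE' ij' dij']]] := seg_relP Fxy'.
  subst x y x' y'.
  (* Overlapping members are neither singletons nor the whole range, so they are not sides. *)
  have Dij : [set i; j] \in D by apply: drawn_diagonal => //; lia.
  have Dij' : [set i'; j'] \in D by apply: drawn_diagonal => //; lia.
  move: fD => /forallP/(_ i)/forallP/(_ j)/forallP/(_ i')/forallP/(_ j').
  rewrite Dij Dij' crosses_lt // xx' x'y yy' /= => /and4P[d1 d2 d3 d4].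
  by rewrite !seg_rel_ord xx' x'y yy' (ltn_trans xx' (ltn_trans x'y yy')) d1 d2 d3 setUC d4.
apply/forallP => a; apply/forallP => b; apply/forallP => c; apply/forallP => d.
apply/implyP => /and3P[abD cdD].
case/existsP => p /existsP[q /existsP[r /existsP[t /and4P[pq qr rt]]]] e.
have drawnC i j : drawn D [set i; j] = drawn D [set j; i] by rewrite setUC.
have [Fpr Fqt] : seg_rel D p r /\ seg_rel D q t.
  rewrite !seg_rel_ord /drawn (ltn_trans pq qr) (ltn_trans qr rt) /=.
  by case/orP: e => /andP[/eqP<- /eqP<-]; rewrite abD cdD !orbT.
have [] := fD p q r t (leq0n _) pq qr rt _ Fpr Fqt; first by rewrite -ltnS.
rewrite !seg_rel_ord pq qr rt (ltn_trans pq (ltn_trans qr rt)) /=.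
move=> d1 d2 d3 d4.
have [d1' d2' d3' d4'] : [/\ drawn D [set q; p], drawn D [set r; q],
    drawn D [set t; r] & drawn D [set t; p]].
  by rewrite !(drawnC t) (drawnC q) (drawnC r).
by case/orP: e => /andP[/eqP/set2_eqP[][-> ->] /eqP/set2_eqP[][-> ->]];
  apply/and4P; split.
Qed.

(** If four drawn sides bound no present quadrilateral, some chosen diagonal crosses a segment
    between two of the vertices. Conversely, a member [[a, c)] or [[b, d)] is a chosen diagonal that
    crosses the other diagonal of the quadrilateral. *)
Lemma has_quadrilateralP D : is_dissection D -> framed (relP (seg_rel D)) 0 n ->
  ~~ has_quadrilateral D <-> quad_split (relP (seg_rel D)) 0 n.
Proof.
move=> dD fD; split=> [nq x y z t _ xy yz zt tn Fxy Fyz Fzt Fxt|qD].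
  have [a [b [aE bE ab dab]]] := seg_relP Fxy.
  have [c [d [cE dE cd dcd]]] := seg_relP Fzt.
  subst x y z t.
  move: (Fyz) (Fxt); rewrite !seg_rel_ord => /andP[_ dbc] /andP[_ dad].
  have : has_quadrilateral D = false by apply/negbTE.
  move=> /existsPn/(_ a)/existsPn/(_ b)/existsPn/(_ c)/existsPn/(_ d).
  rewrite ab yz cd dab dbc dcd dad /=.
  case/forall_inPn => e eD; rewrite negbK.
  case/exists_inP => p pQ /exists_inP[q qQ].
  have [i [j [-> ij _ Fij]]] := dissectionP dD eD.
  move=> h; have pq := crosses_neq h.
  have {p q pQ qQ pq h} [p [q [pQ qQ pq h]]] : exists p q,
      [/\ p \in [set a; b; c; d], q \in [set a; b; c; d], p < q & crosses [set i; j] [set p; q]].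
    case: (ltngtP p q) => [lt|lt|/val_inj E]; first by exists p, q.
      by exists q, p; rewrite (setUC [set q]).
    by rewrite E eqxx in pq.
  rewrite crosses_lt // in h.
  rewrite !inE -!val_eqE /= -!orbA in pQ qQ.
  have jn : j <= n by rewrite -ltnS.
  rewrite -!seg_rel_ord.
  exact: (quad_split_of_cross fD ab yz cd tn Fxy Fyz Fzt Fxt Fij jn pQ qQ h).
apply/existsP => -[a /existsP[b /existsP[c /existsP[d]]]].
case/and5P => ab bc cd dab /and4P[dbc dcd dad /forall_inP nm].
have dn : d <= n by rewrite -ltnS.
have := qD a b c d (leq0n _) ab bc cd dn; rewrite !seg_rel_ord.
rewrite ab bc cd dab dbc dcd dad (ltn_trans ab bc) (ltn_trans bc cd).
rewrite (ltn_trans ab (ltn_trans bc cd)) => /(_ isT isT isT isT) /= [dd|dd].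
  have /negP := nm _ (drawn_diagonal dd ltac:(lia) ltac:(lia)); apply.
  apply/exists_inP; exists b; first by rewrite !inE eqxx orbT.
  by apply/exists_inP; exists d; rewrite ?inE ?eqxx ?orbT // crosses_lt ?ab ?bc ?cd //; lia.
have /negP := nm _ (drawn_diagonal dd ltac:(lia) ltac:(lia)); apply.
apply/exists_inP; exists a; first by rewrite !inE eqxx.
by apply/exists_inP; exists c; rewrite ?inE ?eqxx ?orbT // crosses_lt ?ab ?bc ?cd ?orbT //; lia.
Qed.

End Polygon.

(** * Interval posets *)

Section IntervalPoset.
Variable n : nat.
Implicit Types (s : 'S_n) (B : {set 'I_n}).

Lemma contiguousP B :
  reflect (B != set0 /\ forall i j k : 'I_n, i \in B -> j \in B -> i <= k <= j -> k \in B)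
    (contiguous B).
Proof.
apply: (iffP existsP) => [[a /existsP[b /andP[ab /eqP->]]]|[/set0Pn[i0 i0B] conv]].
  split=> [|i j k]; last by rewrite !inE; lia.
  by apply/set0Pn; exists a; rewrite inE leqnn.
case: (arg_minnP val i0B) => a aB amin; case: (arg_maxnP val i0B) => b bB bmax.
exists a; apply/existsP; exists b; rewrite amin //=.
apply/eqP/setP => k; rewrite inE; apply/idP/idP => [kB|]; last exact: conv.
by apply/andP; split; [apply: amin|apply: bmax].
Qed.

Definition itv (x y : nat) : {set 'I_n} := [set k : 'I_n | x <= k < y].

Lemma contiguous_itv B : contiguous B -> exists x y, [/\ x < y, y <= n & B = itv x y].
Proof.
case/existsP=> a /existsP[b /andP[ab /eqP->]].
by exists a, b.+1; split.
Qed.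

(** Blocks are recorded by their values, so values are ordered by the inverse permutation; [0] fills
    in outside the range. *)
Definition position s (u : nat) : nat := oapp (fun i => val (s^-1%g i)) 0 (insub u).

Lemma position_ord s (i : 'I_n) : position s i = s^-1%g i.
Proof. by rewrite /position valK. Qed.

Lemma position_inj s : inj_on (position s) 0 n.
Proof.
move=> u v /= un vn.
rewrite -[u]/(val (Ordinal un)) -[v]/(val (Ordinal vn)) !position_ord.
by move=> /val_inj/perm_inj ->.
Qed.

Lemma mem_interval_poset s B :
  (B \in interval_poset s) = contiguous B && contiguous (s @^-1: B).
Proof.
have sK (I : {set 'I_n}) : s @^-1: (s @: I) = I.
  by apply/setP => i; rewrite inE mem_imset //; apply: perm_inj.
apply/imsetP/andP => [[I]|[cB cI]].
  by rewrite inE => /andP[cI csI] ->; rewrite sK.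
have sKV : s @: (s @^-1: B) = B.
  apply/setP => i; rewrite -[i](permKV s) mem_imset; last exact: perm_inj.
  by rewrite inE.
by exists (s @^-1: B); rewrite ?inE sKV ?cI.
Qed.

Lemma itv_interval_poset s x y : x < y -> y <= n ->
  itv x y \in interval_poset s <-> block (position s) 0 n x y.
Proof.
move=> xy yn; have xn := leq_trans xy yn.
rewrite mem_interval_poset.
have -> : contiguous (itv x y) = true.
  apply/contiguousP; split=> [|i j k]; last by rewrite !inE; lia.
  by apply/set0Pn; exists (Ordinal xn); rewrite inE leqnn.
split=> [/contiguousP[_ conv] u v z hu hv /= zn|B].
  have un : u < n by lia.
  have vn : v < n by lia.
  rewrite -[u]/(val (Ordinal un)) -[v]/(val (Ordinal vn)) -[z]/(val (Ordinal zn)).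
  rewrite !position_ord => uz zv.
  have := conv (s^-1 (Ordinal un))%g (s^-1 (Ordinal vn))%g (s^-1 (Ordinal zn))%g.
  by rewrite !inE !permKV /= (ltnW uz) (ltnW zv); apply.
apply/contiguousP; split.
  by apply/set0Pn; exists (s^-1 (Ordinal xn))%g; rewrite !inE permKV leqnn.
move=> i j k; rewrite !inE => hi hj /andP[].
rewrite leq_eqVlt => /orP[/eqP/val_inj<- //|ik].
rewrite leq_eqVlt => /orP[/eqP/val_inj-> //|kj].
have lt_pos (p q : 'I_n) : p < q -> position s (s p) < position s (s q).
  by rewrite !position_ord !permK.
exact: (B _ _ _ hi hj (ltn_ord (s k)) (lt_pos _ _ ik) (lt_pos _ _ kj)).
Qed.

(** Quantifying over both ends avoids ordering the unordered pair; only the increasing order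
    contributes. *)
Definition segment_itv (e : {set 'I_n.+1}) : {set 'I_n} :=
  [set k : 'I_n | [exists a in e, exists b in e, a <= k < b]].

Lemma segment_itv_lt (i j : 'I_n.+1) : i < j -> segment_itv [set i; j] = itv i j.
Proof.
move=> ij; apply/setP => k; rewrite !inE; apply/exists_inP/idP.
  case=> a; rewrite !inE => /orP[]/eqP-> /exists_inP[b]; rewrite !inE => /orP[]/eqP->; lia.
move=> h; exists i; first by rewrite set21.
by apply/exists_inP; exists j; rewrite ?set22.
Qed.

Definition diagonals (P : {set {set 'I_n}}) : {set {set 'I_n.+1}} :=
  [set e | is_diagonal e && (segment_itv e \in P)].

Lemma diagonals_dissection P : is_dissection (diagonals P).
Proof. by apply/forall_inP => e; rewrite inE => /andP[]. Qed.

(** The sides left out by [diagonals] encode singletons and the whole range, which are blocks of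
    every permutation. *)
Lemma seg_rel_diagonals s x y : x < y -> y <= n ->
  seg_rel (diagonals (interval_poset s)) x y <-> block (position s) 0 n x y.
Proof.
move=> xy yn; rewrite -itv_interval_poset //.
pose i : 'I_n.+1 := inord x; pose j : 'I_n.+1 := inord y.
have iE : i = x :> nat by rewrite inordK //; lia.
have jE : j = y :> nat by rewrite inordK //; lia.
have ij : i < j by rewrite iE jE.
rewrite -{1}iE -{1}jE seg_rel_ord ij /drawn inE /is_diagonal cards2 neq_ltn ij /=.
rewrite segment_itv_lt // iE jE; case: (boolP (is_side _)) => //=.
rewrite is_side_lt // iE jE => side; split=> // _.
apply/itv_interval_poset => // u v z hu hv hz uz zv.
have [xE|xE] := eqVneq y x.+1; last by move: side; rewrite (negbTE xE); lia.
have uE : u = x by lia.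
have vE : v = x by lia.
by move: uz zv; rewrite uE vE; lia.
Qed.

Lemma diagonals_inj : {in [set interval_poset s | s : 'S_n] &, injective diagonals}.
Proof.
move=> _ _ /imsetP[s _ ->] /imsetP[t _ ->] e.
have sub r r' : diagonals (interval_poset r) = diagonals (interval_poset r') ->
    interval_poset r \subset interval_poset r'.
  move=> err'; apply/subsetP => B BP; have := BP; rewrite mem_interval_poset => /andP[cB _].
  have [x [y [xy yn BE]]] := contiguous_itv cB; rewrite BE in BP *.
  apply/itv_interval_poset/seg_rel_diagonals; rewrite // -err'.
  by apply/seg_rel_diagonals/itv_interval_poset.
by apply/eqP; rewrite eqEsubset !sub.
Qed.

(** Only comparisons matter, so [f] can be replaced by its ranks; these are positions of values,
    whence the inverse in the witness. *)
Lemma permutation_of_order f : inj_on f 0 n ->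
  exists s : 'S_n, forall u v, u < n -> v < n -> (position s u < position s v) = (f u < f v).
Proof.
move=> fi; pose r (i : 'I_n) := #|[set j : 'I_n | f j < f i]|.
have r_lt (i j : 'I_n) : f i < f j -> r i < r j.
  move=> ij; apply: proper_card; apply/properP; split.
    by apply/subsetP => k; rewrite !inE => /ltn_trans; apply.
  by exists i; rewrite !inE ?ltnn.
have rn i : r i < n.
  rewrite -[X in _ < X](card_ord n) -cardsT; apply: proper_card; rewrite properT.
  by apply/negP => /eqP/setP/(_ i); rewrite !inE ltnn.
have r_mono (i j : 'I_n) : (r i < r j) = (f i < f j).
  apply/idP/idP; last exact: r_lt.
  case: (ltngtP (f i) (f j)) => [//|/r_lt|]; first by lia.
  by rewrite /r => ->; rewrite ltnn.
have r_inj : injective (fun i => Ordinal (rn i)).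
  move=> i j [] e; apply: val_inj; apply: fi; rewrite ?ltn_ord //.
  by have := r_mono i j; have := r_mono j i; rewrite e !ltnn; case: ltngtP.
exists (perm r_inj)^-1%g => u v un vn.
rewrite -[u]/(val (Ordinal un)) -[v]/(val (Ordinal vn)) !position_ord invgK !permE /=.
exact: r_mono.
Qed.

End IntervalPoset.

(** * The bijection between interval posets and dissections *)

Lemma framed_eq F G n : (forall x y, x < y -> y <= n -> F x y <-> G x y) ->
  framed F 0 n -> framed G 0 n.
Proof.
move=> FG fF x x' y y' _ xx' x'y yy' y'n Gxy Gxy'.
have [||F1 F2 F3 F4] := fF x x' y y' (leq0n x) xx' x'y yy' y'n.
- by apply/FG => //; lia.
- by apply/FG => //; lia.
by split; apply/FG => //; lia.
Qed.

Lemma quad_split_eq F G n : (forall x y, x < y -> y <= n -> F x y <-> G x y) ->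
  quad_split F 0 n -> quad_split G 0 n.
Proof.
move=> FG fF a b c d _ ab bc cd dn Gab Gbc Gcd Gad.
have [||||F1|F1] := fF a b c d (leq0n a) ab bc cd dn.
- by apply/FG => //; lia.
- by apply/FG => //; lia.
- by apply/FG => //; lia.
- by apply/FG => //; lia.
- by left; apply/FG => //; lia.
- by right; apply/FG => //; lia.
Qed.

Theorem theorem1 (n : nat) (hn : 1 <= n) :
  #|[set interval_poset s | s : 'S_n]| =
  #|[set D : {set {set 'I_n.+1}} |
      [&& is_dissection D, diagonally_framed D & ~~ has_quadrilateral D]]|.
Proof.
(* [diagonals] is injective on interval posets, so it remains to identify its image. *)
rewrite -(card_in_imset (@diagonals_inj n)).
congr #|pred_of_set _|; apply/setP => D; rewrite !inE; apply/imsetP/and3P.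
  move=> [_ /imsetP[s _ ->] ->].
  have dD := diagonals_dissection (interval_poset s).
  have eqF x y : x < y -> y <= n -> block (position s) 0 n x y <->
      seg_rel (diagonals (interval_poset s)) x y.
    by move=> xy yn; exact: iff_sym (seg_rel_diagonals _ xy yn).
  have fD := framed_eq eqF (block_framed (@position_inj _ s)).
  split=> //; first by apply/diagonally_framedP.
  apply/has_quadrilateralP => //.
  exact: quad_split_eq eqF (block_quad_split (@position_inj _ s)).
move=> [dD /(diagonally_framedP dD) fD /(has_quadrilateralP dD fD) qD].
have F1 x : x < n -> seg_rel D x x.+1.
  move=> xn; rewrite /seg_rel ltnSn xn /drawn is_side_lt !inordK ?eqxx //; lia.
have F0 : seg_rel D 0 n.
  by rewrite /seg_rel hn leqnn /drawn is_side_lt !inordK ?eqxx ?orbT.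
(* Surjectivity: an order whose blocks are the members of [seg_rel D] is turned into a
   permutation. *)
have [f [fi fD'] _] := realize fD qD F1 true hn (leqnn n) F0.
have [s sE] := permutation_of_order fi.
exists (interval_poset s); first by apply: imset_f.
apply: seg_rel_inj => // [|x y]; first exact: diagonals_dissection.
have [xy|] := boolP (x < y); last by rewrite /seg_rel => /negbTE->.
have [yn|] := boolP (y <= n); last by rewrite /seg_rel => /negbTE->; rewrite !andbF.
have blkE : block (position s) 0 n x y <-> block f 0 n x y.
  split=> B u v z hu hv hz uz zv; apply: (B u v z) => //.
  - by rewrite sE //; lia.
  - by rewrite sE //; lia.
  - by rewrite -sE //; lia.
  - by rewrite -sE //; lia.
by apply/idP/idP => [/(fD' x y (leq0n x) xy yn)/blkE|] h;
  [apply/seg_rel_diagonals|apply/(fD' x y (leq0n x) xy yn)/blkE/seg_rel_diagonals].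
Qed.
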